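(* For any prime $p\equiv3\pmod4$, we have $$\left|\left\{(j,k):\ 1\le j<k\le\frac{p-1}2\ \text{and}\ \frac14<\left|\left\{\frac{k^2}p\right\}-\left\{\frac{j^2}p\right\}\right|<\frac34\right\}\right|\equiv0\pmod2.$$
   Context: Here $\{x\}=x-\lfloor x\rfloor$ denotes the fractional part of a real number $x$. *)

(* Defs.v *)
From mathcomp Require Import all_boot all_order all_algebra.
From mathcomp Require Import reals.

Set Implicit Arguments.
Unset Strict Implicit.
Unset Printing Implicit Defensive.

Import Order.TTheory GRing.Theory Num.Theory.

Local Open Scope ring_scope.

Definition fracpart (R : realType) (x : R) : R := x - (Num.floor x)%:~R.

(* Main.v *)
Require Import Defs.
From mathcomp Require Import all_boot all_order all_algebra all_field.
From mathcomp Require Import reals zify lra.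

Import Order.TTheory GRing.Theory Num.Theory.

Local Open Scope ring_scope.

(** Write p = 4m + 3. Whether {j, k} is counted depends only on the residue
d = k^2 - j^2 mod p: the distance of two fractional parts a/p and b/p lies in
]1/4, 3/4[ exactly when the representative of a - b in [0, p[ lies in
]p/4, 3p/4[ ([dist_natdiv_lt], [Fp_sub_mid]), an interval stable under d |-> -d
that contains 2m + 2 integers, none of them 0. As j runs over 1, ..., 2m + 1,
j^2 runs once over each nonzero square of F_p. So the number of ordered pairs
(j, k) satisfying the condition is the number of pairs of nonzero squares with
difference in a set of 2m + 2 nonzero residues.

Since p = 3 mod 4, -1 is not a square, and the nonzero squares form a Paley
difference set: every nonzero d is a difference of two nonzero squares in
exactly m ways ([card_diff_reps]). Hence there are (2m + 2) m ordered pairs,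
that is, m (m + 1) unordered ones, and this product of consecutive integers is
even. *)

(** * The Paley difference set of a finite field *)

Section PaleyDifferenceSet.

Variables (F : finFieldType) (m : nat).
Hypothesis cardF : #|F| = (4 * m + 3)%N.

Definition nzsquares : {set F} := [set x ^+ 2 | x in [set~ 0]].

Definition diff_reps (d : F) : {set F * F} :=
  [set xy in setX nzsquares nzsquares | xy.1 - xy.2 == d].

Lemma nzsquares_neq0 x : x \in nzsquares -> x != 0.
Proof. by case/imsetP=> y; rewrite !inE => y0 ->; rewrite expf_neq0. Qed.

Lemma nzsquaresM c x : c \in nzsquares -> x \in nzsquares -> c * x \in nzsquares.
Proof.
case/imsetP=> a; rewrite !inE => a0 -> /imsetP[b]; rewrite !inE => b0 ->.
by rewrite -exprMn; apply: imset_f; rewrite !inE mulf_neq0.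
Qed.

Lemma nzsquaresV c : c \in nzsquares -> c^-1 \in nzsquares.
Proof.
case/imsetP=> a; rewrite !inE => a0 ->.
by rewrite -exprVn; apply: imset_f; rewrite !inE invr_eq0.
Qed.

(** A field of odd order has odd characteristic: translating the sum of all
elements by [x] leaves it unchanged, so [x *+ #|F| = 0], which for odd [#|F|]
is incompatible with [x *+ 2 = 0]. *)
Lemma neq_opp_card3mod4 (x : F) : x != 0 -> x != - x.
Proof.
move=> x0; apply: contraNneq x0 => xN.
have x2 : x *+ 2 = 0 by rewrite mulr2n {1}xN addNr.
have : x *+ #|F| = 0.
  apply: (addrI (\sum_y y)); rewrite -sumr_const -big_split addr0.
  by rewrite [RHS](reindex_inj (addIr x)).
rewrite cardF (_ : 4 * m + 3 = 2 * (2 * m + 1) + 1)%N; last lia.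
by rewrite mulrnDr mulrnA x2 mul0rn add0r mulr1n => ->.
Qed.

(** The unit group has order [2 * (2 * m + 1)], so [x ^+ 2 = -1] would give
[1 = (-1) ^+ (2 * m + 1) = -1]. *)
Lemma opp1_nonsquare (x : F) : x ^+ 2 != -1.
Proof.
have N11 : (1 : F) != -1 by rewrite neq_opp_card3mod4 ?oner_eq0.
apply: contraNneq N11 => x2.
have x0 : x != 0.
  by apply: contra_eq_neq x2 => ->; rewrite expr0n eq_sym oppr_eq0 oner_eq0.
have := expf_card x; rewrite cardF => xq.
have : x ^+ (2 * (2 * m + 1)) = 1.
  by apply: (mulIf x0); rewrite -exprSr mul1r -[RHS]xq; congr (_ ^+ _); lia.
by rewrite exprM x2 addn1 exprS mulnC exprM sqrr_sign mulr1 => ->.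
Qed.

(** Squaring is two-to-one on nonzero elements, with fibers [{x, - x}]. *)
Lemma card_nzsquares : #|nzsquares| = (2 * m + 1)%N.
Proof.
suff: (2 * #|nzsquares| = #|[set~ 0%R : F]|)%N by rewrite cardsC1 cardF; lia.
rewrite -[RHS]sum1_card.
rewrite (partition_big (fun x : F => x ^+ 2) (mem nzsquares)) /=; last first.
  by move=> x x0; apply: imset_f.
rewrite mulnC -sum_nat_const; apply: eq_bigr => _ /imsetP[x x0 ->].
rewrite sum1dep_card -[LHS](_ : #|[set x; - x]| = _).
  apply: eq_card => y; rewrite !inE eqf_sqr andb_idl //.
  move: x0; rewrite !inE => x0 /orP[] /eqP-> //.
  by rewrite oppr_eq0.
by rewrite cards2 neq_opp_card3mod4 //; rewrite !inE in x0.
Qed.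

(** As [-1] is not a square, the nonzero squares and their opposites are
disjoint; each of the two sets contains half of the nonzero elements. *)
Lemma nzsquares_or_opp d : d != 0 -> (d \in nzsquares) || (- d \in nzsquares).
Proof.
move=> d0; set N := [set - x | x in nzsquares].
suff /setP/(_ d) : nzsquares :|: N = [set~ 0].
  rewrite !inE d0 => /orP[-> // | /imsetP[x xQ ->]].
  by rewrite opprK xQ orbT.
apply/eqP; rewrite eqEcard; apply/andP; split.
  apply/subsetP => x; rewrite !inE => /orP[/nzsquares_neq0 // | /imsetP[y yQ ->]].
  by rewrite oppr_eq0 nzsquares_neq0.
have disj : nzsquares :&: N = set0.
  apply/setP => x; rewrite !inE; apply/negbTE/negP => /andP[xQ /imsetP[y yQ xy]].
  have := nzsquaresM _ _ xQ (nzsquaresV _ yQ).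
  rewrite xy mulNr divff ?nzsquares_neq0 // => /imsetP[z _ /eqP].
  by rewrite eq_sym (negbTE (opp1_nonsquare z)).
rewrite cardsU disj cards0 (card_imset _ oppr_inj).
by rewrite cardsC1 card_nzsquares cardF; lia.
Qed.

(** Multiplication by a nonzero square [c] permutes the nonzero squares and
maps the representations of [d] onto those of [c * d]. *)
Lemma card_diff_repsM c d : c \in nzsquares ->
  #|diff_reps (c * d)| = #|diff_reps d|.
Proof.
move=> cQ; have c0 := nzsquares_neq0 _ cQ.
pose f (xy : F * F) := (c * xy.1, c * xy.2).
have f_inj : injective f by case=> x y [x' y'] [/(mulfI c0)-> /(mulfI c0)->].
rewrite -[RHS](card_imset _ f_inj); apply: eq_card => -[x y].
apply/idP/imsetP => [|[[x' y'] + [-> ->]]]; rewrite !inE /=.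
- case/andP=> /andP[xQ yQ] /eqP xy.
  exists (c^-1 * x, c^-1 * y); last by rewrite /f /= !mulVKf.
  by rewrite !inE /= !nzsquaresM ?nzsquaresV //= -mulrBr xy mulKf.
- by case/andP=> /andP[xQ yQ] /eqP<-; rewrite !nzsquaresM //= mulrBr.
Qed.

Lemma card_diff_repsN d : #|diff_reps (- d)| = #|diff_reps d|.
Proof.
have swapK : involutive (fun xy : F * F => (xy.2, xy.1)) by case.
rewrite -[RHS](card_imset _ (inv_inj swapK)) (can2_imset_pre _ swapK swapK).
by apply: eq_card => -[x y]; rewrite !inE /= -eqr_opp opprB opprK (andbC (y \in _)).
Qed.

(** By the two invariances above, all nonzero [d] have the same number [N] of
representations. Sorting the [(2 * m + 1) ^ 2] pairs of nonzero squares by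
their difference, [2 * m + 1] of them being diagonal, gives
[(2 * m + 1) ^ 2 = (2 * m + 1) + (4 * m + 2) * N]. *)
Lemma card_diff_reps d : d != 0 -> #|diff_reps d| = m.
Proof.
have reps1 e : e != 0 -> #|diff_reps e| = #|diff_reps 1|.
  move=> /nzsquares_or_opp /orP[eQ|NeQ].
    by rewrite -[in LHS](mulr1 e) card_diff_repsM.
  by rewrite -card_diff_repsN -[in LHS](mulr1 (- e)) card_diff_repsM.
move=> /reps1->; set N := #|_|.
have reps0 : #|diff_reps 0| = (2 * m + 1)%N.
  rewrite -card_nzsquares -[RHS](@card_imset _ _ (fun x : F => (x, x)));
    last by move=> x y [].
  apply: eq_card => -[x y]; rewrite !inE /= subr_eq0.
  apply/andP/imsetP => [[/andP[xQ _] /eqP <-]|[z zQ [-> ->]]]; first by exists x.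
  by rewrite zQ.
have := cardsX nzsquares nzsquares.
rewrite -sum1_card (partition_big (fun xy : F * F => xy.1 - xy.2) xpredT) //=.
under eq_bigr => e _ do rewrite sum1dep_card.
rewrite (bigD1 0) //= -[X in (X + _)%N]/(#|diff_reps 0|) reps0.
rewrite (eq_bigr (fun=> N)) => [|e e0]; last by rewrite /N -(reps1 e e0).
rewrite (eq_bigl [in [set~ 0]]) => [|e]; last by rewrite !inE.
rewrite sum_nat_const cardsC1 cardF card_nzsquares; nia.
Qed.

Lemma card_pairs_diff_in (E : {set F}) : 0 \notin E ->
  #|[set xy in setX nzsquares nzsquares | xy.1 - xy.2 \in E]| = (#|E| * m)%N.
Proof.
move=> E0; rewrite -sum1_card.
rewrite (partition_big (fun xy : F * F => xy.1 - xy.2) (mem E)) /=; last first.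
  by move=> xy; rewrite !inE => /andP[].
rewrite -sum_nat_const; apply: eq_bigr => d dE.
have d0 : d != 0 by apply: contraNneq E0 => <-.
rewrite sum1dep_card -[RHS](card_diff_reps d d0); apply: eq_card => xy.
by rewrite !inE -andbA; case: eqP => [->|]; rewrite ?dE ?andbF.
Qed.

End PaleyDifferenceSet.

(** * From fractional parts to residues *)

Lemma fracpart_natdiv (R : realType) (a p : nat) : (0 < p)%N ->
  fracpart (a%:R / p%:R : R) = (a %% p)%:R / p%:R.
Proof.
move=> p0; have pR : 0 < (p%:R : R) by rewrite ltr0n.
have aE : a%:R / p%:R = (a %/ p)%:R + (a %% p)%:R / p%:R :> R.
  by rewrite {1}(divn_eq a p) natrD natrM mulrDl mulfK ?gt_eqF.
suff fl : Num.floor (a%:R / p%:R : R) = (a %/ p)%:Z.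
  by rewrite /fracpart fl {1}aE -pmulrn addrC addKr.
apply: floor_def; rewrite -[(_ + 1)]/((a %/ p) + 1)%:Z -!pmulrn aE natrD.
by rewrite lerDl divr_ge0 ?ler0n //= ltrD2l ltr_pdivrMr // mul1r ltr_nat ltn_mod.
Qed.

(** With truncated subtraction, [(a - b) + (b - a)] is the distance of the
natural numbers [a] and [b]. *)
Lemma dist_natdiv_lt (R : realType) (a b p : nat) : (0 < p)%N ->
  (1 / 4 < `|(a%:R / p%:R : R) - b%:R / p%:R| < 3 / 4) =
  (p < 4 * ((a - b) + (b - a)) < 3 * p)%N.
Proof.
move=> p0; have pR : 0 < (p%:R : R) by rewrite ltr0n.
have -> : `|a%:R / p%:R - b%:R / p%:R| = ((a - b) + (b - a))%N%:R / p%:R :> R.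
  rewrite -mulrBl normrM normfV (ger0_norm (ltW pR)); congr (_ / _).
  case: (leqP a b) => ab.
    by rewrite distrC -natrB // (eqP ab) add0n ger0_norm ?ler0n.
  by rewrite -natrB ?(ltnW ab) // (eqP (ltnW ab)) addn0 ger0_norm ?ler0n.
rewrite ltr_pdivlMr // ltr_pdivrMr // -(ltr_nat R) -(ltr_nat R) !natrM.
by congr (_ && _); apply/idP/idP => h; lra.
Qed.

(** The representative of [x - y] is the distance of the representatives of [x]
and [y], or [p] minus this distance; the interval ]p/4, 3p/4[ is symmetric
about p/2, so both give the same answer. *)
Lemma Fp_sub_mid (p : nat) (x y : 'F_p) : prime p ->
  (p < 4 * ((x - y) + (y - x)) < 3 * p)%N = (p < 4 * (x - y)%R < 3 * p)%N.
Proof.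
move=> pp; have ltp (z : 'F_p) : (z < p)%N by rewrite -[X in (_ < X)%N]Fp_cast.
have xE : nat_of_ord x = ((y + (x - y)%R) %% p)%N.
  by rewrite -[in LHS](subrK y x) addrC; congr (_ %% _)%N; apply: Fp_cast.
have := ltp x; have := ltp y; have := ltp (x - y)%R.
move: xE; case: (ltnP (y + (x - y)%R) p) => h.
  rewrite modn_small //; lia.
rewrite -(subnK h) modnDr modn_small;
  last by have := ltp y; have := ltp (x - y)%R; lia.
lia.
Qed.

Lemma card_ord_itv (N a b : nat) : (b <= N)%N ->
  #|[set i : 'I_N | a <= i < b]%N| = (b - a)%N.
Proof.
move=> bN; rewrite -sum1dep_card -(big_mkord (fun i => a <= i < b)%N (fun=> 1%N)).
rewrite -[RHS]muln1 -sum_nat_const_nat; case: (leqP a b) => ab; last first.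
  by rewrite [RHS]big_geq ?(ltnW ab) // big1 // => i; lia.
by rewrite [RHS](big_nat_widenl a 0) // [RHS](big_nat_widen 0 b N) //.
Qed.

(** * Counting the pairs *)

Theorem corollary1p2 (R : realType) (p : nat)
    (p_prime : prime p) (p_mod4 : (p = 3 %[mod 4])%N) :
  (#|[set jk : 'I_p * 'I_p |
       let: (j, k) := jk in
       [&& 1 <= j, j < k, k <= (p - 1) %/ 2
         & (1 / 4 < `|fracpart (k%:R ^+ 2 / p%:R : R)
                        - fracpart (j%:R ^+ 2 / p%:R)| < 3 / 4)%R]]|
     = 0 %[mod 2])%N.
Proof.
set S := [set _ | _].
have p0 := prime_gt0 p_prime.
pose m := (p %/ 4)%N; have pE : p = (4 * m + 3)%N by rewrite /m; lia.
have cardF : #|'F_p| = (4 * m + 3)%N by rewrite card_Fp.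
pose sq (k : 'I_p) : 'F_p := k%:R ^+ 2.
pose H := [set k : 'I_p | 1 <= k < 2 * m + 2]%N.
pose E := [set d : 'F_p | p < 4 * d < 3 * p]%N.
have sqE k : nat_of_ord (sq k) = (k ^ 2 %% p)%N.
  by rewrite /sq -natrX val_Fp_nat.
pose T := [set jk in setX H H | sq jk.1 - sq jk.2 \in E].
have condE (j k : 'I_p) :
    ((1 / 4 < `|fracpart (k%:R ^+ 2 / p%:R : R)
                        - fracpart (j%:R ^+ 2 / p%:R)| < 3 / 4)%R)
    = (sq k - sq j \in E).
  by rewrite -!natrX !fracpart_natdiv // dist_natdiv_lt // inE -Fp_sub_mid // !sqE.
have EN d : (- d \in E) = (d \in E).
  by rewrite !inE -[in LHS](sub0r d) -[in RHS](subr0 d) -!Fp_sub_mid // addnC.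
have E0 : 0 \notin E by rewrite inE.
have cardE : #|E| = (2 * m + 2)%N.
  transitivity (3 * m + 3 - (m + 1))%N; last lia.
  rewrite -(card_ord_itv (Zp_trunc (pdiv p)).+2); last by rewrite Fp_cast //; lia.
  by apply: eq_card => d; rewrite !inE; lia.
(* [j ^+ 2 = k ^+ 2] leaves [j = - k] to exclude, and [0 < j + k < p] in [H]. *)
have sq_inj : {in H &, injective sq}.
  move=> j k; rewrite !inE => jH kH /eqP; rewrite /sq eqf_sqr => /orP[] /eqP jk.
    apply: val_inj; move/(congr1 (@nat_of_ord _)): jk.
    by rewrite !val_Fp_nat // !modn_small.
  have : (j + k)%:R = 0 :> 'F_p by rewrite natrD jk addNr.
  by move/(congr1 (@nat_of_ord _)); rewrite val_Fp_nat // modn_small /=; lia.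
(* Both sides have [2 * m + 1] elements. *)
have imH : sq @: H = nzsquares 'F_p.
  apply/eqP; rewrite eqEcard (card_in_imset sq_inj) (card_nzsquares _ m) //.
  rewrite card_ord_itv; last lia.
  apply/andP; split; last lia.
  apply/subsetP=> _ /imsetP[k kH ->]; apply: imset_f; rewrite !inE in kH *.
  apply: contraTneq kH => /(congr1 (@nat_of_ord _)).
  by rewrite val_Fp_nat // modn_small //= => ->.
have cardT : #|T| = ((2 * m + 2) * m)%N.
  rewrite -cardE -(card_pairs_diff_in _ m cardF) //.
  pose f (jk : 'I_p * 'I_p) := (sq jk.1, sq jk.2).
  have f_inj : {in T &, injective f}.
    move=> [j k] [j' k']; rewrite inE in_setX => /andP[/andP[jH kH] _].
    rewrite inE in_setX => /andP[/andP[jH' kH'] _] ff.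
    by rewrite (sq_inj j j' jH jH' (congr1 fst ff))
               (sq_inj k k' kH kH' (congr1 snd ff)).
  rewrite -(card_in_imset f_inj).
  apply: eq_card => -[x y]; rewrite inE in_setX -imH.
  apply/imsetP/andP => [[[j k] + [-> ->]]|
    [/andP[/imsetP[j jH xj] /imsetP[k kH yk]] xy]].
    by rewrite inE in_setX => /andP[/andP[/= jH kH] ->]; rewrite !imset_f.
  exists (j, k); last by rewrite xj yk.
  by rewrite inE in_setX jH kH /= -xj -yk.
pose swap (jk : 'I_p * 'I_p) := (jk.2, jk.1).
have swapK : involutive swap by case.
have memS j k :
    ((j, k) \in S) = [&& 0 < j, j < k, k < 2 * m + 2 & (sq k - sq j)%R \in E]%N.
  by rewrite inE -condE (_ : (p - 1) %/ 2 = 2 * m + 1)%N ?addn1 ?addn2 //; lia.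
have memT j k : ((j, k) \in T) =
    [&& 0 < j < 2 * m + 2, 0 < k < 2 * m + 2 & (sq j - sq k)%R \in E]%N.
  by rewrite inE in_setX -andbA /=; congr [&& _, _ & _]; rewrite inE.
(* An ordered pair in [T] is off the diagonal since [0] is not in [E], so
   either it or its swap is increasing. *)
have TE : T = S :|: swap @: S.
  rewrite (can2_imset_pre _ swapK swapK); apply/setP => -[j k].
  rewrite in_setU [_ \in swap @^-1: S]inE memT !memS -(EN (sq j - sq k)) opprB /=.
  case: (ltngtP j k) => [||/val_inj->].
  - by case: (sq k - sq j \in E); lia.
  - by case: (sq k - sq j \in E); lia.
  by rewrite subrr (negbTE E0) !andbF.
have disj : S :&: swap @: S = set0.
  rewrite (can2_imset_pre _ swapK swapK); apply/setP => -[j k].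
  rewrite in_setI [_ \in swap @^-1: S]inE !memS in_set0.
  by case: (ltngtP j k); rewrite ?andbF.
have := cardT; rewrite TE cardsU disj cards0 subn0 (card_imset _ (inv_inj swapK)).
move=> cardSS; have -> : #|S| = (m.+1 * m)%N by nia.
by rewrite !modn2 oddM /=; case: odd.
Qed.
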